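(* Let $m\ge 3$ be an integer and let $G$ be a finite, simple, undirected, connected graph that is $K_{1,m}$-free and has diameter $2$. Then \[ cc(G)\le c(G)+2m-2, \] where $c(G)$ is the cop number of $G$ (in the ordinary game of Cops and Robbers) and $cc(G)$ is the minimum number of cops that have a winning strategy in the game of Cops and Attacking Robbers on $G$.
   Context: All graphs are finite, connected, simple and undirected. A graph is $K_{1,m}$-free if it has no induced subgraph isomorphic to the star $K_{1,m}$ (so $K_{1,3}$-free means claw-free). Cops and Robbers: the game is played on a graph $G$ with full information by two players, one controlling a set of cops and the other a single robber. The cops first choose initial vertices (several cops may occupy the same vertex), and then the robber chooses an initial vertex. After that the cops and the robber move alternately, with the cops moving first. On the cops' turn each cop either moves to a neighbouring vertex or stays where she is (any subset of the cops may move). On the robber's turn he either moves to a neighbouring vertex or stays where he is. The cops win if after finitely many rounds some cop occupies the same vertex as the robber (a capture); the robber wins if he can avoid capture indefinitely. The cop number $c(G)$ is the minimum number of cops for which the cops have a winning strategy on $G$. Cops and Attacking Robbers: the rules are the same, except that on his turn the robber may attack a cop: if he moves to a neighbouring vertex on which a cop is present, one cop on that vertex is eliminated (removed from the game). If that vertex contains exactly one cop, she is removed, the robber is not captured by this move, and the game continues with the remaining cops. If it contains two or more cops, only one of them is eliminated, and a remaining cop on that vertex then captures the robber, so the cops win. The robber may not start the game on a vertex occupied by a cop. The parameter $cc(G)$ is the minimum number of cops for which the cops have a winning strategy on $G$ in this game. *)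

(* Defs.v *)
From mathcomp Require Import all_boot.
From mathcomp Require Import boolp.

Set Implicit Arguments.
Unset Strict Implicit.
Unset Printing Implicit Defensive.

(* Classical logic (boolp) is used only to turn the (undecided) proposition
   "k cops have a winning strategy" into a boolean, so that ex_minn applies. *)

Record sgraph := SGraph {
  vertex :> finType;
  adj : rel vertex;
  adj_sym : symmetric adj;
  adj_irr : irreflexive adj
}.

Definition connected (G : sgraph) : Prop :=
  0 < #|G| /\ forall x y : G, connect (@adj G) x y.

Definition walk (G : sgraph) (n : nat) (x y : G) : bool :=
  [exists p : n.-tuple G, path (@adj G) x p && (last x p == y)].

(* The least length of a walk from x to y.  A shortest walk repeats no vertex,
   so lengths below #|G| suffice; the junk value #|G| means "not connected". *)
Definition dist (G : sgraph) (x y : G) : nat :=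
  find (fun n => walk n x y) (iota 0 #|G|).

Definition diameter (G : sgraph) : nat :=
  \max_(x : G) \max_(y : G) dist x y.

Definition has_induced (H G : sgraph) : Prop :=
  exists h : H -> G, injective h /\ forall x y : H, adj (h x) (h y) = adj x y.

(* K_{1,m}: the centre is None, the leaves are the Some i with i : 'I_m. *)
Definition star_adj (m : nat) : rel (option 'I_m) :=
  fun x y => isSome x != isSome y.

Lemma star_adj_sym m : symmetric (@star_adj m).
Proof. by move=> x y; rewrite /star_adj eq_sym. Qed.

Lemma star_adj_irr m : irreflexive (@star_adj m).
Proof. by move=> x; rewrite /star_adj eqxx. Qed.

Definition star (m : nat) : sgraph :=
  SGraph (@star_adj_sym m) (@star_adj_irr m).

Definition star_free (m : nat) (G : sgraph) : Prop := ~ has_induced (star m) G.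

Definition step (G : sgraph) : rel G := fun x y => (x == y) || adj x y.

(* The list of cops is moved entrywise (all2 also forces equal sizes). *)
Definition cops_step (G : sgraph) (C C' : seq G) : bool := all2 (@step G) C C'.

(* [cops_win C r]: with cops at C, the robber at r and the cops to move (unless
   r is already captured), the cops have a winning strategy.  A derivation is
   such a strategy, given as its tree of plays: it fixes one cop move at each
   position reached and branches over all robber moves.  Being inductive, it
   has no infinite branch, so every play ends in a capture after finitely many
   rounds. *)
Inductive cops_win (G : sgraph) (C : seq G) (r : G) : Prop :=
| cops_win_capture of r \in C
| cops_win_capture_move C' of cops_step C C' & r \in C'
| cops_win_round C' of cops_step C C'
    & (forall r' : G, step r r' -> cops_win C' r').

Definition cops_have_win (G : sgraph) (k : nat) : Prop :=
  exists2 C : seq G, size C = k & forall r : G, cops_win C r.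

(* The same for the game with an attacking robber.  When the robber moves from
   r to r', exactly one occurrence of r' is removed from the cops C', if there
   is one (otherwise rem r' C' = C').  If another cop remains on r', the
   robber is captured by the first constructor.  Since a robber sharing a
   vertex with a cop after the cops' move is captured, the last constructor
   requires r \notin C', so that staying put (r' = r) never eliminates
   a cop. *)
Inductive attack_win (G : sgraph) (C : seq G) (r : G) : Prop :=
| attack_win_capture of r \in C
| attack_win_capture_move C' of cops_step C C' & r \in C'
| attack_win_round C' of cops_step C C' & r \notin C'
    & (forall r' : G, step r r' -> attack_win (rem r' C') r').

(* The robber may not start on a cop. *)
Definition attack_have_win (G : sgraph) (k : nat) : Prop :=
  exists2 C : seq G, size C = k & forall r : G, r \notin C -> attack_win C r.

(* One cop on every vertex wins both games. *)
Lemma cops_have_win_ex (G : sgraph) : exists k, `[< cops_have_win G k >].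
Proof.
exists #|G|; apply/asboolP; exists (enum G); first by rewrite cardE.
by move=> r; apply: cops_win_capture; rewrite mem_enum.
Qed.

Lemma attack_have_win_ex (G : sgraph) : exists k, `[< attack_have_win G k >].
Proof.
exists #|G|; apply/asboolP; exists (enum G); first by rewrite cardE.
by move=> r; rewrite mem_enum.
Qed.

Definition cop_number (G : sgraph) : nat := ex_minn (cops_have_win_ex G).

Definition attack_cop_number (G : sgraph) : nat :=
  ex_minn (attack_have_win_ex G).

(* Main.v *)
Require Import Defs.
From mathcomp Require Import all_boot.
From mathcomp Require Import boolp.

Set Implicit Arguments.
Unset Strict Implicit.
Unset Printing Implicit Defensive.

(* The cops play an optimal strategy of the ordinary game, supported by m - 1
   guards.  Suppose the strategy moves cops onto a set A of neighbours of the
   robber.  A maximal independent subset I of A has fewer than m vertices, and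
   in diameter 2 every guard is one move away from the closed neighbourhood of
   any vertex, so each vertex of I gets its own guard in its closed
   neighbourhood.  Then every cop the robber can attack has another cop within
   distance 1 (a vertex of I and its guard protect each other, and the rest of
   A is dominated by I), so that an attack is answered by a capture.  Hence even
   cc(G) <= c(G) + m - 1. *)

Lemma step_refl (G : sgraph) : reflexive (@step G).
Proof. by move=> x; rewrite /step eqxx. Qed.

Lemma step_sym (G : sgraph) : symmetric (@step G).
Proof. by move=> x y; rewrite /step eq_sym adj_sym. Qed.

Lemma cops_step_refl (G : sgraph) : reflexive (@cops_step G).
Proof. by elim=> [|x C IH] //=; rewrite /cops_step /= step_refl. Qed.

Lemma cops_step_cat (G : sgraph) (C C' D D' : seq G) :
  cops_step C C' -> cops_step D D' -> cops_step (C ++ D) (C' ++ D').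
Proof.
rewrite /cops_step; elim: C C' => [|x C IH] [|x' C'] //= /andP[-> CC'] DD'.
exact: IH.
Qed.

Lemma attack_win_step (G : sgraph) (C : seq G) (c r : G) :
  c \in C -> step c r -> attack_win C r.
Proof.
move=> /path.splitPr[C1 C2] cr.
apply: (@attack_win_capture_move _ _ _ (C1 ++ r :: C2)).
  apply: cops_step_cat; first exact: cops_step_refl.
  by rewrite /cops_step /= cr; apply: cops_step_refl.
by rewrite mem_cat mem_head orbT.
Qed.

Lemma rem_catl (T : eqType) (x : T) (s t : seq T) :
  x \in s -> rem x (s ++ t) = rem x s ++ t.
Proof.
elim: s => //= z s IH; rewrite inE eq_sym; case: eqP => //= _ /IH -> //.
Qed.

(** Greedy choice: an entry joins [t] only if its closed neighbourhood misses everything chosen so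
    far, so a rejected entry is already dominated. *)
Lemma independent_dominating (G : sgraph) (s : seq G) :
  exists t : seq G, [/\ uniq t, {subset t <= s},
    {in t &, forall a b, step a b -> a = b} &
    {in s, forall a, exists2 b, b \in t & step a b}].
Proof.
elim: s => [|x s [t [ut ts indep dom]]]; first by exists [::].
have [xt|/hasPn xt] := boolP (has (step x) t).
  exists t; split=> // [a /ts|a]; first by rewrite inE orbC => ->.
  by rewrite inE => /predU1P[->|/dom //]; apply/hasP.
exists (x :: t); split.
- by rewrite /= ut andbT; apply/negP => /xt; rewrite step_refl.
- by move=> a; rewrite !inE => /predU1P[->|/ts ->]; rewrite ?eqxx ?orbT.
- move=> a b; rewrite !inE => /predU1P[->|aT] /predU1P[->|bT] //; last exact: indep.
    by rewrite (negPf (xt b bT)).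
  by rewrite step_sym (negPf (xt a aT)).
- move=> a; rewrite inE => /predU1P[->|/dom[b bt ab]].
    by exists x; [rewrite mem_head | rewrite step_refl].
  by exists b; rewrite // inE bt orbT.
Qed.

(** Otherwise [r] as centre and the first [m] entries of [t] as leaves would induce a star. *)
Lemma star_free_independent (m : nat) (G : sgraph) (r : G) (t : seq G) :
  star_free m G -> uniq t -> {in t, forall a, adj r a} ->
  {in t &, forall a b, step a b -> a = b} -> size t < m.
Proof.
move=> free ut rt indep; rewrite ltnNge; apply/negP => mt; apply: free.
have lt (i : 'I_m) : i < size t by apply: leq_trans (ltn_ord i) mt.
exists (fun o : star m => if o is Some i then nth r t (i : 'I_m) else r); split.
  move=> [i|] [j|] //= eq_ij.
  - by congr Some; apply/val_inj/eqP; rewrite -(nth_uniq r (lt i) (lt j) ut) eq_ij.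
  - by have := rt _ (mem_nth r (lt i)); rewrite eq_ij adj_irr.
  - by have := rt _ (mem_nth r (lt j)); rewrite -eq_ij adj_irr.
move=> [i|] [j|] /=; rewrite /star_adj /= ?adj_irr //.
- apply/negP => ij.
  have eq_ij : nth r t i = nth r t j.
    by apply: indep; rewrite ?mem_nth // /step ij orbT.
  by rewrite eq_ij adj_irr in ij.
- by rewrite adj_sym rt ?mem_nth.
- by rewrite rt ?mem_nth.
Qed.

Lemma walk_exists (G : sgraph) (x y : G) :
  connected G -> exists2 n, n < #|G| & walk n x y.
Proof.
move=> [_ /(_ x y)/connectP[p xp ->]].
case/shortenP: xp => q xq uq _; exists (size q).
  by rewrite -[_.+1]/(size (x :: q)) -(card_uniqP uq) max_card.
by apply/existsP; exists (in_tuple q); rewrite xq eqxx.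
Qed.

(** Connectedness makes the search by [find] succeed, which rules out the junk value of [dist]. *)
Lemma dist_walk (G : sgraph) (x y : G) : connected G -> walk (dist x y) x y.
Proof.
move=> /walk_exists-/(_ x y)[n nG xy].
have hasw : has (fun k => walk k x y) (iota 0 #|G|).
  by apply/hasP; exists n; rewrite ?mem_iota.
have := nth_find 0 hasw; rewrite nth_iota //.
by move: hasw; rewrite has_find size_iota.
Qed.

Lemma dist_le_diameter (G : sgraph) (x y : G) : dist x y <= diameter G.
Proof.
have le_y := @leq_bigmax _ (fun y => dist x y) y.
apply: leq_trans le_y _.
exact: (@leq_bigmax _ (fun x => \max_(y : G) dist x y) x).
Qed.

Lemma diameter2_step (G : sgraph) (x y : G) :
  connected G -> diameter G <= 2 -> exists2 z, step x z & step z y.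
Proof.
move=> conn diam.
have := leq_trans (dist_le_diameter x y) diam.
have := dist_walk x y conn; rewrite /walk.
move: (dist x y) => n /existsP[[p /= /eqP <-]].
case: p => [|z [|w [|v p]]] //=.
- by move=> /eqP <- _; exists x; rewrite step_refl.
- by rewrite andbT => /andP[xz /eqP <-] _; exists z; rewrite ?step_refl // /step xz orbT.
- by rewrite andbT => /andP[/andP[xz zw] /eqP <-] _; exists z; rewrite /step ?xz ?zw orbT.
Qed.

(** Guards are assigned to the entries of [s] in order, and the surplus ones stay put. The last
    clause limits where a guard can later be attacked. *)
Lemma guard_move (G : sgraph) (D s : seq G) :
  (forall x y : G, exists2 z, step x z & step z y) -> size s <= size D ->
  exists D', [/\ cops_step D D',
    {in s, forall a, exists2 g, g \in D' & step g a} &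
    {in D', forall g, g \in D \/ exists2 a, a \in s & step g a}].
Proof.
move=> near; elim: s D => [|a s IH] [|x D] //= sD.
- by exists [::].
- by exists (x :: D); split=> //; [apply: (cops_step_refl (x :: D)) | left].
have [D' [DD' guard from]] := IH D sD; have [z xz za] := near x a.
exists (z :: D'); split.
- by rewrite /cops_step /= xz.
- move=> b; rewrite inE => /predU1P[->|/guard[g gD gb]].
    by exists z; rewrite ?mem_head.
  by exists g; rewrite // inE gD orbT.
- move=> g; rewrite inE => /predU1P[->|/from[gD|[b bs gb]]].
  + by right; exists a; rewrite ?mem_head.
  + by left; rewrite inE gD orbT.
  + by right; exists b; rewrite // inE bs orbT.
Qed.

(** Induction on the ordinary strategy, with [D] general because the guards move every round. Only
    their number is invariant; the first attack is answered by an immediate capture. *)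
Lemma attack_win_guards (m : nat) (G : sgraph) (C D : seq G) (r : G) :
  star_free m G -> (forall x y : G, exists2 z, step x z & step z y) ->
  m <= (size D).+1 -> cops_win C r -> attack_win (C ++ D) r.
Proof.
move=> free near mD win; elim: win D mD => {C r}.
- by move=> C r rC D _; apply: attack_win_capture; rewrite mem_cat rC.
- move=> C r C' CC' rC' D _.
  apply: (@attack_win_capture_move _ _ _ (C' ++ D)); last by rewrite mem_cat rC'.
  exact: cops_step_cat CC' (cops_step_refl D).
move=> C r C' CC' _ IH D mD.
(* A cop within reach of the robber captures at once. Otherwise [far] shows that no vertex held
   before the move, in particular by a guard that stays put, is open to attack. *)
have [/hasP[c cD cr]|/hasPn far] := boolP (has (fun c => step c r) (C ++ D)).
  exact: attack_win_step cD cr.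
have [t [ut tA indep dom]] := independent_dominating [seq a <- C' | adj r a].
have tP a : a \in t -> adj r a /\ a \in C' by move/tA; rewrite mem_filter => /andP.
have tm : size t < m.
  by apply: (star_free_independent (r := r) free ut _ indep) => a /tP[].
have [D' [DD' guard from]] : exists D', [/\ cops_step D D',
    {in t, forall a, exists2 g, g \in D' & step g a} &
    {in D', forall g, g \in D \/ exists2 a, a \in t & step g a}].
  by apply: guard_move => //; rewrite -ltnS (leq_trans tm).
have move_all := cops_step_cat CC' DD'.
have [rCD|rCD] := boolP (r \in C' ++ D').
  exact: attack_win_capture_move move_all rCD.
apply: (attack_win_round move_all rCD) => r' rr'.
have [r'CD|r'CD] := boolP (r' \in C' ++ D'); last first.
  (* No cop is attacked, so the guards keep their number and the ordinary strategy goes on. *)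
  rewrite rem_id //; apply: IH => //.
  by move: DD'; rewrite /cops_step all2E => /andP[/eqP <- _].
have adj_rr' : adj r r'.
  by case/orP: rr' => // /eqP eq_r; rewrite eq_r r'CD in rCD.
have [r'C|r'C] := boolP (r' \in C').
  have [|b bt r'b] := dom r'; first by rewrite mem_filter adj_rr'.
  (* If [r'] is itself in [t], its guard recaptures: [rem] deletes the occurrence in [C'], so the
     guard survives even when standing on [r']. Otherwise the cop on the dominating vertex [b] is
     untouched and recaptures. *)
  have [eq_b|neq_b] := eqVneq b r'.
    have [g gD gb] := guard _ bt; rewrite eq_b in gb.
    by apply: (attack_win_step _ gb); rewrite rem_catl // mem_cat gD orbT.
  rewrite step_sym in r'b; apply: (attack_win_step _ r'b).
  by apply: rem_mem; rewrite // mem_cat (tP _ bt).2.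
(* Only a guard stands on [r']. By [far] it is one sent towards some [a] in [t], and the cop of [C']
   on [a] recaptures. *)
have := r'CD; rewrite mem_cat (negPf r'C) => /from[r'D|[a ta r'a]].
  by have := far r'; rewrite mem_cat r'D orbT step_sym rr' => /(_ isT).
rewrite step_sym in r'a; apply: (attack_win_step _ r'a).
have aC := (tP _ ta).2; apply: rem_mem; last by rewrite mem_cat aC.
by apply: contraNneq r'C => <-.
Qed.

Theorem theorem10 (m : nat) (G : sgraph) (hm : 3 <= m)
  (hconn : connected G) (hfree : star_free m G) (hdiam : diameter G = 2) :
  attack_cop_number G <= cop_number G + 2 * m - 2.
Proof.
have near (x y : G) : exists2 z, step x z & step z y.
  by apply: diameter2_step; rewrite ?hdiam.
have /card_gt0P[g _] := hconn.1.
rewrite /attack_cop_number /cop_number.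
case: ex_minnP => n _ min_n; case: ex_minnP => k /asboolP[C sizeC winC] _.
(* The guards may start anywhere, so all are placed on one arbitrary vertex [g]; their number is at
   least [m - 1]. *)
apply: min_n; apply/asboolP; exists (C ++ nseq (2 * m - 2) g).
  by rewrite size_cat size_nseq sizeC addnBA // mul2n -addnn ltn_addl // ltnW // ltnW.
move=> r _; apply: attack_win_guards hfree near _ (winC r).
rewrite size_nseq mul2n -addnn -addnBA ?(ltnW hm) //.
by rewrite -addnS leq_addr.
Qed.
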